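(* Let $p>3$ be a prime. Then $$\sum_{k=0}^{(p-1)/2}\frac{\binom{2k}k\binom{4k}{2k}}{(2k-1)64^k}\equiv(-1)^{\frac{p+1}2}\frac{p+1}2\pmod{p^2},$$ $$\sum_{k=0}^{(p-1)/2}\frac{\binom{2k}k\binom{3k}{k}}{(2k-1)27^k}\equiv\frac19\Big(\frac p3\Big)\big(2^{p+1}-7-6p\big)\pmod{p^2},$$ $$\sum_{k=0}^{(p-1)/2}\frac{\binom{3k}k\binom{6k}{3k}}{(2k-1)432^k}\equiv-\frac19\Big(\frac p3\Big)\big(2^{p+1}+2+3p\big)\pmod{p^2}.$$
   Context: $\big(\frac p3\big)$ is the Legendre symbol ($1$ if $p\equiv1\pmod 3$, $-1$ if $p\equiv 2\pmod 3$). Congruences are in the ring of rationals with denominators prime to $p$. *)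

(* Defs.v *)
From mathcomp Require Import all_boot all_order all_algebra.

Set Implicit Arguments.
Unset Strict Implicit.
Unset Printing Implicit Defensive.

Import Order.TTheory GRing.Theory Num.Theory.
Local Open Scope ring_scope.

(* Membership in the ring of rationals with denominator prime to [p]; [denq]
   is the denominator in lowest terms. *)
Definition pintegral (p : nat) (x : rat) : Prop := coprimez p%:Z (denq x).

(* Congruence modulo [p ^ n] in that ring: both sides lie in the ring, and they
   differ by an element of the ideal generated by [p ^ n]. *)
Definition pcongr (p n : nat) (x y : rat) : Prop :=
  [/\ pintegral p x, pintegral p y
    & exists2 z : rat, pintegral p z & x - y = p%:R ^+ n * z].

(* Legendre symbol (a / 3). *)
Definition legendre3 (a : nat) : rat :=
  if (a %% 3)%N == 1%N then 1 else if (a %% 3)%N == 2%N then - 1 else 0.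

(* Main.v *)
(* Up to the substitution x -> -1 - x, the three sums are the values at
   x = -1/4, -1/3, -1/6 of S(x) = sum_(k <= n) C(x, k) C(-1 - x, k) / (2k - 1),
   n = (p - 1)/2, and one of x, -1 - x has the form m + p t with t = -1/d
   (d = 4, 3, 6) and m = floor(p / d) < n.  The quotient S(x) / (2x + 1) changes
   from x to x + 1 by 2 T(x) / ((x + 1)(2x + 1)(2x + 3)), where
   T(x) = (x + 1 + n) C(x, n) C(-1 - x, n), and T(j + p t) = p t mod p^2 for
   0 <= j < n.  Summing over j < m expresses S(m + p t) mod p^2 through the
   alternating harmonic sums at p - 1 and 2m.  The former is congruent to
   (2^p - 2)/p mod p, and reflection k -> p - k relates the latter to it. *)
From HB Require Import structures.
Require Import Defs.
From mathcomp Require Import all_boot all_order all_algebra.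
From mathcomp Require Import zify ring lra.

Import Order.TTheory GRing.Theory Num.Theory.
Local Open Scope ring_scope.

(** * Rationals integral at p and their congruences *)

(** The condition of [pintegral] as a boolean predicate, so that it can carry a subring
    structure. *)
Definition zp (p : nat) : {pred rat} := fun x => coprimez p%:Z (denq x).

(** Any denominator prime to p will do, since by Gauss's lemma [denq x] divides it. Closure under
    sums and products then follows by multiplying denominators. *)
Lemma zpP (p : nat) (x : rat) :
  reflect (exists d : int,
             [/\ d != 0, coprimez p%:Z d & d%:~R * x \is a Num.int])
    (x \in zp p).
Proof.
apply: (iffP idP) => [xp|[d [d0 cpd /intrP[z dxz]]]].
  exists (denq x); split=> //.
  by rewrite -{2}(divq_num_den x) mulrC divfK ?intr_eq0 ?denq_neq0 ?rpred_int.
have e : d * numq x = z * denq x.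
  apply: (@intr_inj rat); rewrite !rmorphM /= -dxz -{2}(divq_num_den x).
  by rewrite -mulrA divfK // intr_eq0 denq_neq0.
have dvd : (denq x %| d)%Z.
  have : (denq x %| d * numq x)%Z by rewrite e dvdz_mull.
  by rewrite Gauss_dvdzl // coprimezE coprime_sym coprime_num_den.
by rewrite unfold_in; apply: coprimez_dvdr dvd cpd.
Qed.

Lemma zp_subring_closed p : subring_closed (zp p).
Proof.
split.
- by apply/zpP; exists 1; split=> //; rewrite ?coprimezE ?coprimen1 ?mulr1 ?rpred_int.
- move=> x y /zpP[d [d0 cd dx]] /zpP[e [e0 ce ey]]; apply/zpP.
  exists (d * e); split; rewrite ?mulf_neq0 ?coprimezMr ?cd //.
  rewrite rmorphM /=.
  have -> : d%:~R * e%:~R * (x - y)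
            = e%:~R * (d%:~R * x) - d%:~R * (e%:~R * y) :> rat by ring.
  by rewrite rpredB // rpredM // rpred_int.
- move=> x y /zpP[d [d0 cd dx]] /zpP[e [e0 ce ey]]; apply/zpP.
  exists (d * e); split; rewrite ?mulf_neq0 ?coprimezMr ?cd //.
  by rewrite rmorphM /= mulrACA rpredM.
Qed.

HB.instance Definition _ p :=
  GRing.isSubringClosed.Build rat (zp p) (zp_subring_closed p).

Lemma zp_invn (p n : nat) : coprime p n -> n%:R^-1 \in zp p.
Proof.
case: (eqVneq n 0%N) => [->|n0 cpn]; first by rewrite invr0 rpred0.
apply/zpP; exists n%:Z; split=> //.
by rewrite -pmulrn divff ?rpred1 // pnatr_eq0.
Qed.

(** The hypothesis says that the p-adic valuation of [x] is at most 0. So p does not divide the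
    numerator, which then serves as a denominator of [x^-1]. *)
Lemma zp_inv (p : nat) (x : rat) : prime p -> x / p%:R \notin zp p ->
  x^-1 \in zp p.
Proof.
move=> pp xp; have p0 : p%:R != 0 :> rat by rewrite pnatr_eq0 -lt0n prime_gt0.
apply/zpP; exists (numq x).
have x0 : x != 0 by apply: contraNneq xp => ->; rewrite mul0r rpred0.
split; first by rewrite numq_eq0.
  rewrite coprimezE absz_nat prime_coprime //; apply: contra xp => pn.
  have /dvdzP[q nq] : (p%:Z %| numq x)%Z by [].
  apply/zpP; exists (denq x); split; first exact: denq_neq0.
    rewrite coprimezE absz_nat prime_coprime //.
    apply/negP => pd; have := coprime_num_den x.
    move=> /(coprime_dvdl pn) /(coprime_dvdr pd).
    by rewrite /coprime gcdnn; case: p pp {pn pd nq p0} => [|[]].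
  have -> : (denq x)%:~R * (x / p%:R) = q%:~R; last exact: rpred_int.
  rewrite -{2}(divq_num_den x) nq rmorphM /= -pmulrn.
  by field; rewrite p0 intr_eq0 denq_neq0.
have -> : (numq x)%:~R * x^-1 = (denq x)%:~R; last exact: rpred_int.
by rewrite -{2}(divq_num_den x) invf_div mulrCA divff ?mulr1 ?intr_eq0 ?numq_eq0.
Qed.

Lemma zp_natdiv (p n : nat) : prime p -> (n%:R / p%:R \in zp p) = (p %| n)%N.
Proof.
move=> pp; have p0 : p%:R != 0 :> rat by rewrite pnatr_eq0 -lt0n prime_gt0.
apply/idP/idP => [|/dvdnP[q ->]]; last by rewrite natrM mulfK // rpred_nat.
move=> /zpP[d [d0 cd /intrP[z e]]].
have e' : d * n%:Z = z * p%:Z.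
  apply: (@intr_inj rat); rewrite !rmorphM /= -!pmulrn -e.
  by field.
suff: (p%:Z %| n%:Z)%Z by [].
by rewrite -(Gauss_dvdzr _ cd) e' dvdz_mull.
Qed.

(** Unlike [pcongr], this constrains only the difference, so congruences chain without carrying the
    integrality of both sides. *)
Definition cg (p n : nat) (x y : rat) := (x - y) / p%:R ^+ n \in zp p.

Lemma cgP (p n : nat) (x y : rat) : (0 < p)%N ->
  reflect (exists2 z, z \in zp p & x = y + p%:R ^+ n * z) (cg p n x y).
Proof.
move=> p0; have pn0 : p%:R ^+ n != 0 :> rat by rewrite expf_neq0 // pnatr_eq0 -lt0n.
apply: (iffP idP) => [h|[z hz ->]].
  by exists ((x - y) / p%:R ^+ n); rewrite // mulrC divfK // addrC subrK.
by rewrite /cg addrC addKr mulrAC divff ?mul1r.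
Qed.

Lemma cg_refl p n x : cg p n x x.
Proof. by rewrite /cg subrr mul0r rpred0. Qed.

Lemma cg_sym p n x y : cg p n x y -> cg p n y x.
Proof. by rewrite /cg -opprB mulNr rpredN. Qed.

Lemma cg_trans p n y x z : cg p n x y -> cg p n y z -> cg p n x z.
Proof.
rewrite /cg => h k; suff -> : x - z = (x - y) + (y - z) by rewrite mulrDl rpredD.
by ring.
Qed.

Lemma cgD p n x x' y y' : cg p n x x' -> cg p n y y' ->
  cg p n (x + y) (x' + y').
Proof.
rewrite /cg => h k.
suff -> : x + y - (x' + y') = (x - x') + (y - y') by rewrite mulrDl rpredD.
by ring.
Qed.

Lemma cgMl p n a x y : a \in zp p -> cg p n x y -> cg p n (a * x) (a * y).
Proof. by rewrite /cg => h k; rewrite -mulrBr -mulrA rpredM. Qed.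

Lemma cgN p n x y : cg p n x y -> cg p n (- x) (- y).
Proof. by rewrite /cg => k; rewrite -opprD mulNr rpredN. Qed.

Lemma cg_sum p n (I : Type) (r : seq I) (P : pred I) (F G : I -> rat) :
  (forall i, P i -> cg p n (F i) (G i)) ->
  cg p n (\sum_(i <- r | P i) F i) (\sum_(i <- r | P i) G i).
Proof. by move=> h; rewrite /cg -sumrB mulr_suml rpred_sum. Qed.

(** A factor p gains one power in the modulus: a cofactor of p is needed only mod p when working mod
    p^2. *)
Lemma cg_pM p n x y : (0 < p)%N -> cg p n x y -> cg p n.+1 (p%:R * x) (p%:R * y).
Proof.
move=> p0; have p0' : p%:R != 0 :> rat by rewrite pnatr_eq0 -lt0n.
rewrite /cg => h; suff -> : (p%:R * x - p%:R * y) / p%:R ^+ n.+1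
  = (x - y) / p%:R ^+ n by [].
by rewrite exprS; field; rewrite p0' expf_neq0.
Qed.

(** * The sums S(x) and their shift *)

Ltac zp_tac := repeat first
  [ assumption
  | lazymatch goal with
    | |- is_true (_ + _ \in _) => apply: rpredD
    | |- is_true (- _ \in _) => rewrite rpredN
    | |- is_true (_ * _ \in _) => apply: rpredM
    | |- is_true (_ ^+ _ \in _) => apply: rpredX
    | |- is_true (_%:R \in _) => exact: rpred_nat
    | |- is_true (1 \in _) => exact: rpred1
    end ].

Ltac nz_tac := by repeat (apply/andP; split); apply: lt0r_neq0; lra.

Lemma zp_inv_lt (p k : nat) : prime p -> (0 < k < p)%N -> k%:R^-1 \in zp p.
Proof.
move=> pp /andP[k0 kp]; apply: zp_invn; rewrite prime_coprime //.
by apply/negP => /dvdn_leq; lia.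
Qed.

(* [lprod x k] is C(x, k) C(-1 - x, k), which depends on x only through
   x (x + 1). *)
Definition lprod (x : rat) (k : nat) : rat :=
  \prod_(i < k) ((i%:R * i.+1%:R - x * (x + 1)) / i.+1%:R ^+ 2).

Lemma lprod0 x : lprod x 0 = 1.
Proof. by rewrite /lprod big_ord0. Qed.

Lemma lprodS x k :
  lprod x k.+1 = lprod x k * ((k%:R * k.+1%:R - x * (x + 1)) / k.+1%:R ^+ 2).
Proof. by rewrite /lprod big_ord_recr. Qed.

Lemma lprod_reflect x k : lprod (- 1 - x) k = lprod x k.
Proof. by apply: eq_bigr => i _; congr (_ / _); ring. Qed.

Lemma natS_neq0 k : 1 + k%:R != 0 :> rat.
Proof. by rewrite nat1r pnatr_eq0. Qed.

Lemma odd_neq0 k : 2 * k%:R - 1 != 0 :> rat.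
Proof.
apply/eqP => h; suff : (2 * k)%N%:R = 1%N%:R :> rat by move/eqP; rewrite eqr_nat; lia.
by rewrite natrM; lra.
Qed.

(** The ratios C(x+1, k) / C(x, k) = (x+1) / (x+1-k) and C(-2-x, k) / C(-1-x, k) = (x+1+k) / (x+1)
    are multiplied and cleared of denominators. *)
Lemma lprod_shift x k :
  (x + 1 - k%:R) * lprod (x + 1) k = (x + 1 + k%:R) * lprod x k.
Proof.
elim: k => [|k IH]; first by rewrite !lprod0; ring.
rewrite !lprodS; have k0 := natS_neq0 k.
have -> : (x + 1 - k.+1%:R) * (lprod (x + 1) k *
     ((k%:R * k.+1%:R - (x + 1) * (x + 1 + 1)) / k.+1%:R ^+ 2))
  = ((x + 1 - k%:R) * lprod (x + 1) k) *
     ((k%:R - x) * (k%:R + x + 2) / k.+1%:R ^+ 2) by field.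
by rewrite IH; field.
Qed.

Definition lsum (x : rat) (n : nat) : rat :=
  \sum_(0 <= k < n.+1) lprod x k / (2 * k%:R - 1).

(** In the k-th term of the combination the factor 2k - 1 cancels, because (2x+1)(x+1+k) -
    (2x+3)(x+1-k) = 2(x+1)(2k-1). What remains has a closed form in n, checked by induction. *)
Lemma lsum_shift x n : (forall k : nat, x + 1 - k%:R != 0) ->
  (2 * x + 1) * lsum (x + 1) n - (2 * x + 3) * lsum x n
  = 2 * ((x + 1 + n%:R) * lprod x n) / (x + 1).
Proof.
move=> hx; have x0 : x + 1 != 0 by have := hx 0; rewrite subr0.
have step k : (2 * x + 1) * (lprod (x + 1) k / (2 * k%:R - 1))
   - (2 * x + 3) * (lprod x k / (2 * k%:R - 1))
   = lprod x k * (2 * (x + 1)) / (x + 1 - k%:R).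
  have -> : lprod (x + 1) k = (x + 1 + k%:R) * lprod x k / (x + 1 - k%:R).
    by rewrite -lprod_shift mulrAC divff ?mul1r.
  by have := odd_neq0 k; have := hx k => h1 h2; field; rewrite h2 h1.
elim: n => [|n IH].
  by rewrite /lsum !big_nat1 step lprod0; field; rewrite x0; have := hx 0; rewrite subr0.
rewrite /lsum !(big_nat_recr n.+1) //= -!/(lsum _ _) 2!mulrDr opprD addrACA IH step.
rewrite lprodS; have := hx n.+1; rewrite -natr1 => h.
by field; rewrite x0 h natr1 pnatr_eq0.
Qed.

(** At x = pt the factor i = 0 is -pt(1 + pt), and each factor i > 0 is i / (i+1) mod p, so the
    product telescopes. *)
Lemma lprod_small (p k : nat) (t : rat) : prime p -> t \in zp p ->
  (0 < k < p)%N -> cg p 2 (lprod (p%:R * t) k) (- (p%:R * t / k%:R)).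
Proof.
move=> pp tp; have p0 := prime_gt0 pp.
case: k => // k; elim: k => [|k IH] kp.
  apply/cgP => //; exists (- t ^+ 2); first by zp_tac.
  by rewrite lprodS lprod0; field.
have [||z zz e] := cgP _ _ _ _ _ (IH _); [by []|lia|].
apply/cgP => //; rewrite lprodS e.
have h1 : k.+1%:R^-1 \in zp p by apply: zp_inv_lt => //; lia.
have h2 : k.+2%:R^-1 \in zp p by apply: zp_inv_lt => //; lia.
exists ((z * (k.+1%:R * k.+2%:R - p%:R * t * (p%:R * t + 1))
   + t ^+ 2 * (p%:R * t + 1) * k.+1%:R^-1) * (k.+2%:R^-1) ^+ 2); first by zp_tac.
field.
by rewrite natS_neq0 -natrD pnatr_eq0.
Qed.

Definition altH (N : nat) : rat := \sum_(i < N) (- 1) ^+ i / i.+1%:R.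

Lemma altHS N : altH N.+1 = altH N + (- 1) ^+ N / N.+1%:R.
Proof. by rewrite /altH big_ord_recr. Qed.

Lemma altH_evenS n :
  altH (2 * n.+1) = altH (2 * n) + (2 * n).+1%:R^-1 - (2 * n.+1)%:R^-1.
Proof.
have e : (-1) ^+ (2 * n) = 1 :> rat by rewrite exprM sqrrN !expr1n.
by rewrite mulnS !altHS exprS e mulr1 mulN1r mul1r.
Qed.

Lemma natr_odd n : (2 * n).+1%:R = 2 * n%:R + 1 :> rat.
Proof. by rewrite -natrM natr1. Qed.

(** Two consecutive terms of the alternating sum pair up: 1 / (k(2k-1)) = 2 (1 / (2k-1) - 1 /
    (2k)). *)
Lemma altH_double n :
  \sum_(0 <= k < n) (k.+1%:R * (2 * k.+1%:R - 1))^-1 = 2 * altH (2 * n).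
Proof.
elim: n => [|n IH]; first by rewrite big_nil /altH muln0 big_ord0 mulr0.
rewrite big_nat_recr //= IH altH_evenS natr_odd natrM.
have n0 : 0 <= n%:R :> rat by rewrite ler0n.
by field; nz_tac.
Qed.

Lemma altH_zp p N : prime p -> (N < p)%N -> altH N \in zp p.
Proof.
move=> pp Np; apply: rpred_sum => i _; apply: rpredM.
  by apply: rpredX; rewrite rpredN rpred1.
by apply: zp_inv_lt; have := ltn_ord i; lia.
Qed.

(** * Evaluation of S(m + p t) modulo p^2 *)

(** If p divided k + pz it would divide k, which lies strictly between 0 and p. *)
Lemma near_unit (p k : nat) (z : rat) : prime p -> z \in zp p ->
  (0 < k < p)%N -> k%:R + p%:R * z != 0 /\ (k%:R + p%:R * z)^-1 \in zp p.
Proof.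
move=> pp zz kp.
have p0 : p%:R != 0 :> rat by rewrite pnatr_eq0 -lt0n prime_gt0.
have h : (k%:R + p%:R * z) / p%:R \notin zp p.
  apply/negP => h; have : (k%:R / p%:R : rat) \in zp p.
    have -> : k%:R / p%:R = (k%:R + p%:R * z) / p%:R - z by field.
    by rewrite rpredB.
  by rewrite zp_natdiv // => /dvdn_leq; lia.
split; last exact: zp_inv.
by apply: contraNneq h => ->; rewrite mul0r rpred0.
Qed.

Lemma cgV p n x y : x != 0 -> y != 0 -> x^-1 \in zp p -> y^-1 \in zp p ->
  cg p n x y -> cg p n x^-1 y^-1.
Proof.
move=> x0 y0 hx hy h.
have xyz : x^-1 * y^-1 \in zp p by exact: rpredM.
have := cgMl _ _ _ _ _ xyz (cg_sym _ _ _ _ h).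
have -> : x^-1 * y^-1 * y = x^-1 by field; rewrite x0.
by have -> : x^-1 * y^-1 * x = y^-1 by field; rewrite y0.
Qed.

Lemma cgM p n x x' y y' : x \in zp p -> y' \in zp p ->
  cg p n x x' -> cg p n y y' -> cg p n (x * y) (x' * y').
Proof.
move=> hx hy' h k; apply: cg_trans (cgMl _ _ _ _ _ hx k) _.
by rewrite mulrC (mulrC x'); exact: cgMl.
Qed.

Lemma cg_inv_near (p k : nat) (z : rat) : prime p -> z \in zp p ->
  (0 < k < p)%N -> cg p 1 (k%:R + p%:R * z)^-1 k%:R^-1.
Proof.
move=> pp zz kp; have [h0 hz] := near_unit _ _ _ pp zz kp.
apply: cgV => //; first by rewrite pnatr_eq0; lia.
  exact: zp_inv_lt.
by apply/cgP; rewrite ?prime_gt0 //; exists z.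
Qed.

(** The term k = 0 gives -1. For 1 <= k <= n the denominator 2k - 1 is below p, hence a unit, and
    [lprod_small] applies termwise. *)
Lemma lsum_small (p n : nat) (t : rat) : prime p -> p = n.*2.+1 ->
  t \in zp p ->
  cg p 2 (lsum (p%:R * t) n) (- 1 - 2 * (p%:R * t) * altH (2 * n)).
Proof.
move=> pp pn tp; rewrite /lsum big_nat_recl // lprod0.
have -> : 1 / (2 * 0%:R - 1) = -1 :> rat by field.
apply: cgD; first exact: cg_refl.
have -> : - (2 * (p%:R * t) * altH (2 * n))
  = \sum_(0 <= k < n) (- (p%:R * t) * (k.+1%:R * (2 * k.+1%:R - 1))^-1).
  by rewrite -mulr_sumr altH_double; ring.
rewrite !(big_nat _ _ 0 n) /=; apply: cg_sum => k kn.
have e : 2 * k.+1%:R - 1 = (2 * k).+1%:R :> rat by rewrite natr_odd -natr1; ring.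
rewrite [X in cg _ _ X _]mulrC e.
have -> : - (p%:R * t) * (k.+1%:R * (2 * k).+1%:R)^-1
   = (2 * k).+1%:R^-1 * (- (p%:R * t / k.+1%:R)).
  by field; rewrite natS_neq0 -natrM natS_neq0.
by apply: cgMl; [apply: zp_inv_lt|apply: lprod_small] => //; lia.
Qed.

(** This is T(j + pt). By [lprod_shift], T(a+1) = T(a) (a+2+n) / (a+1-n), and p = 2n+1 makes the
    ratio 1 + p / (a+1-n). As T(a) already has a factor p, it does not change mod p^2. *)
Lemma lprod_shifted_small (p n j : nat) (t : rat) : prime p -> p = n.*2.+1 ->
  t \in zp p -> (j < n)%N ->
  cg p 2 ((j%:R + p%:R * t + 1 + n%:R) * lprod (j%:R + p%:R * t) n) (p%:R * t).
Proof.
move=> pp pn tp; have p0 := prime_gt0 pp.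
have pE : p%:R = 2 * n%:R + 1 :> rat by rewrite pn -natr1 -mul2n natrM.
elim: j => [|j IH] jn.
  have n0 : n%:R != 0 :> rat by rewrite pnatr_eq0 -lt0n.
  have hn : n%:R^-1 \in zp p by apply: zp_inv_lt => //; lia.
  have [||z zz e] := cgP _ _ _ _ _ (lprod_small p n t pp tp _); [by []|lia|].
  apply/cgP => //; rewrite add0r e.
  (* Since n + 1 = p - n, the coefficient -(n+1) / n of pt equals 1 - p / n. *)
  exists (z * (p%:R * t + 1 + n%:R) - t ^+ 2 * n%:R^-1 - t * n%:R^-1); first by zp_tac.
  by rewrite !pE; field.
have [//|z zz e] := cgP _ _ _ _ _ (IH (ltnW jn)).
set a := j%:R + p%:R * t in e *.
(* The denominator a + 1 - n is a unit because j + 1 < n; its sign is changed to fit [near_unit]. *)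
have [d0 dz] : (n - j.+1)%:R + p%:R * (- t) != 0
     /\ ((n - j.+1)%:R + p%:R * (- t))^-1 \in zp p.
  by apply: near_unit; rewrite ?rpredN //; lia.
have dE : (n - j.+1)%:R + p%:R * (- t) = - (a + 1 - n%:R).
  by rewrite natrB 1?ltnW // -natr1 /a; ring.
have -> : j.+1%:R + p%:R * t = a + 1 by rewrite -natr1 /a; ring.
have hs := lprod_shift a n.
move: d0 dz; rewrite dE => d0 dz.
have -> : (a + 1 + 1 + n%:R) * lprod (a + 1) n
   = (a + 1 + 1 + n%:R) * (p%:R * t + p%:R ^+ 2 * z) / (a + 1 - n%:R).
  rewrite -e -hs; field; move: d0; rewrite oppr_eq0 //.
apply/cgP => //.
exists (z - (t + p%:R * z) * (- (a + 1 - n%:R))^-1); first by zp_tac.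
have -> : a + 1 + 1 + n%:R = a + 1 - n%:R + p%:R by rewrite pE; ring.
by field; move: d0; rewrite oppr_eq0 => ->.
Qed.

(** Induction on m for the quotient of the sum by 2a + 1. The variable [a] with its equation allows
    a literal such as -1/4 to be substituted later. *)
Lemma lsum_congr (p n m : nat) (t : rat) : prime p -> p = n.*2.+1 ->
  t \in zp p -> p%:R * t \isn't a Num.int -> (m < n)%N ->
  forall a, a = m%:R + p%:R * t -> cg p 2 (lsum a n)
    ((2 * a + 1) * (- 1 - 2 * (p%:R * t) * altH (2 * n)
        + 4 * (p%:R * t) * altH (2 * m) + 2 * (p%:R * t) / (2 * m).+1%:R)).
Proof.
move=> pp pn tp tint mn _ ->; have p0 := prime_gt0 pp.
have odd_unit j : (j < n)%N -> 2 * (j%:R + p%:R * t) + 1 != 0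
    /\ (2 * (j%:R + p%:R * t) + 1)^-1 \in zp p.
  move=> jn; have -> : 2 * (j%:R + p%:R * t) + 1 = (2 * j).+1%:R + p%:R * (2 * t).
    by rewrite natr_odd; ring.
  by apply: near_unit => //; [zp_tac|lia].
suff h : cg p 2 (lsum (m%:R + p%:R * t) n / (2 * (m%:R + p%:R * t) + 1))
    (- 1 - 2 * (p%:R * t) * altH (2 * n)
        + 4 * (p%:R * t) * altH (2 * m) + 2 * (p%:R * t) / (2 * m).+1%:R).
  have [u0 _] := odd_unit m mn.
  have hz : 2 * (m%:R + p%:R * t) + 1 \in zp p by zp_tac.
  have := cgMl _ _ _ _ _ hz h.
  by rewrite [X in cg _ _ X]mulrC divfK.
elim: m mn => [|m IH] mn.
  (* At m = 0, 1 / (2pt + 1) = 1 - 2pt mod p^2 turns the leading -1 into -1 + 2pt, whence the last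
     term of the formula. *)
  rewrite add0r muln0 /(altH 0) big_ord0 mulr0 addr0 divr1.
  have [u0 uz] := odd_unit 0 mn; rewrite add0r in u0 uz.
  have [//|z zz ->] := cgP _ _ _ _ _ (lsum_small p n t pp pn tp).
  have Az : altH (2 * n) \in zp p by apply: altH_zp => //; lia.
  apply/cgP => //.
  exists ((z + 4 * t ^+ 2 * altH (2 * n) - 4 * t ^+ 2) * (2 * (p%:R * t) + 1)^-1).
    by zp_tac.
  by field.
have k1 : (0 < m.+1 < p)%N by lia.
have k2 : (0 < (2 * m).+1 < p)%N by lia.
have k3 : (0 < (2 * m.+1).+1 < p)%N by lia.
have h1 : m.+1%:R^-1 \in zp p by apply: zp_inv_lt.
have h2 : (2 * m).+1%:R^-1 \in zp p by apply: zp_inv_lt.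
have h3 : (2 * m.+1).+1%:R^-1 \in zp p by apply: zp_inv_lt.
have [u0 uz] := odd_unit m (ltnW mn); have [v0 vz] := odd_unit m.+1 mn.
have [w0 wz] : m.+1%:R + p%:R * t != 0 /\ (m.+1%:R + p%:R * t)^-1 \in zp p.
  by apply: near_unit.
set a := m%:R + p%:R * t in IH u0 uz *.
have aE : m.+1%:R + p%:R * t = a + 1 by rewrite -natr1 /a; ring.
rewrite !aE in v0 vz w0 wz *.
(* A zero of a + 1 - k would make pt an integer. *)
have ha (k : nat) : a + 1 - k%:R != 0.
  apply: contra tint => /eqP h.
  have -> : p%:R * t = k%:R - m.+1%:R by rewrite -natr1; move: h; rewrite /a => h; lra.
  by rewrite rpredB // rpred_nat.
have e := lsum_shift a n ha.
have -> : lsum (a + 1) n / (2 * (a + 1) + 1) = lsum a n / (2 * a + 1)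
   + 2 * ((a + 1)^-1 * (2 * a + 1)^-1 * (2 * (a + 1) + 1)^-1) *
     ((a + 1 + n%:R) * lprod a n).
  suff -> : lsum (a + 1) n = (2 * ((a + 1 + n%:R) * lprod a n) / (a + 1)
      + (2 * a + 3) * lsum a n) / (2 * a + 1).
    by field; rewrite v0 u0 w0.
  by rewrite -e; field.
set B := - 1 - _.
(* Partial fractions: 2 / ((m+1)(2m+1)(2m+3)) = 2 / (2m+1) - 2 / (m+1) + 2 / (2m+3). *)
have -> : B + 4 * (p%:R * t) * altH (2 * m.+1) + 2 * (p%:R * t) / (2 * m.+1).+1%:R
  = B + 4 * (p%:R * t) * altH (2 * m) + 2 * (p%:R * t) / (2 * m).+1%:R
    + p%:R * (2 * t * (m.+1%:R^-1 * (2 * m).+1%:R^-1 * (2 * m.+1).+1%:R^-1)).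
  rewrite altH_evenS !natr_odd natrM.
  have m0 : 0 <= m%:R :> rat by rewrite ler0n.
  by field; nz_tac.
apply: cgD; first by apply: IH; exact: ltnW.
set D := (a + 1)^-1 * _ * _.
have Dz : D \in zp p by rewrite /D; zp_tac.
apply: cg_trans (_ : cg _ _ _ (2 * D * (p%:R * t))) _.
  by apply: cgMl; [zp_tac|apply: lprod_shifted_small => //; exact: ltnW].
(* With the factor p split off, [D] matters only mod p, where a may be replaced by m. *)
have -> : 2 * D * (p%:R * t) = p%:R * (2 * t * D) by ring.
apply: cg_pM => //; apply: cgMl; first by zp_tac.
apply: cgM; [by zp_tac|by []| |].
  apply: cgM => //.
    by rewrite -aE; apply: cg_inv_near.
  have -> : 2 * a + 1 = (2 * m).+1%:R + p%:R * (2 * t) by rewrite natr_odd /a; ring.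
  by apply: cg_inv_near => //; zp_tac.
have -> : 2 * (a + 1) + 1 = (2 * m.+1).+1%:R + p%:R * (2 * t).
  by rewrite natr_odd -aE; ring.
by apply: cg_inv_near => //; zp_tac.
Qed.

(** * Alternating harmonic sums modulo p *)

(** By Pascal's rule two neighbours in row p - 1 add up to an entry of row p, a multiple of p. *)
Lemma bin_pred_congr p k : prime p -> (k < p)%N ->
  cg p 1 'C(p.-1, k)%:R ((- 1) ^+ k).
Proof.
move=> pp; elim: k => [|k IH] kp; first by rewrite bin0; exact: cg_refl.
have [q e] : exists q, 'C(p, k.+1) = (q * p)%N.
  by apply/dvdnP; apply: prime_dvd_bin.
have -> : 'C(p.-1, k.+1)%:R = - 'C(p.-1, k)%:R + p%:R * q%:R :> rat.
  have := binS p.-1 k; rewrite prednK ?prime_gt0 // => eS.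
  by rewrite -natrM mulnC -e eS natrD; ring.
rewrite exprS mulN1r -[X in cg _ _ _ X]addr0; apply: cgD.
  by apply: cgN; apply: IH; exact: ltnW.
by apply/cgP; rewrite ?prime_gt0 //; exists q%:R; rewrite ?rpred_nat // add0r.
Qed.

(** Expand (1 + 1)^p: the two end terms make 2, and the others are C(p, i+1) = p C(p-1, i) / (i+1),
    with C(p-1, i) = (-1)^i mod p. *)
Lemma altH_fermat p : prime p -> cg p 2 (p%:R * altH p.-1) (2 ^+ p - 2).
Proof.
move=> pp; have p0 := prime_gt0 pp.
have -> : 2 ^+ p - 2 = p%:R * \sum_(i < p.-1) (i.+1%:R^-1 * 'C(p.-1, i)%:R) :> rat.
  have -> : 2 = 1 + 1 :> rat by ring.
  rewrite exprDn -(prednK p0) big_ord_recl big_ord_recr /= /bump /= add1n prednK // bin0 binn.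
  rewrite subnn !expr1n !mulr1n mulr_sumr.
  rewrite [X in _ + (X + _) - _](eq_bigr
    (fun i : 'I_p.-1 => p%:R * (i.+1%:R^-1 * 'C(p.-1, i)%:R))); first by ring.
  move=> i _; rewrite /= !expr1n mulr1 /bump /= add1n.
  apply: (@mulfI _ i.+1%:R); first by rewrite pnatr_eq0.
  by rewrite -natrM -mul_bin_diag natrM; field; rewrite natS_neq0.
apply: cg_pM => //; apply: cg_sum => i _; rewrite mulrC.
have ip : (i.+1 < p)%N by have := ltn_ord i; lia.
apply: cgMl; first exact: zp_inv_lt.
by apply: cg_sym; apply: bin_pred_congr => //; exact: ltnW.
Qed.

Lemma cg_inv_opp p i j : prime p -> (0 < i)%N -> (0 < j)%N -> (i + j = p)%N ->
  cg p 1 i%:R^-1 (- j%:R^-1).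
Proof.
move=> pp i0 j0 ij; apply/cgP; first exact: prime_gt0.
exists (i%:R^-1 * j%:R^-1); first by zp_tac; apply: zp_inv_lt => //; lia.
by rewrite -ij natrD; field; rewrite !pnatr_eq0 -!lt0n i0 j0.
Qed.

(** Under k -> p - k with p odd, the sign and the inverse of k both change sign mod p, so the last N
    terms repeat the first N. *)
Lemma altH_reflect p N : prime p -> odd p -> (N < p)%N ->
  cg p 1 (altH (p.-1 - N)) (altH p.-1 - altH N).
Proof.
move=> pp po; elim: N => [|N IH] Np.
  by rewrite subn0 /(altH 0) big_ord0 subr0; exact: cg_refl.
have e : (p.-1 - N = (p.-1 - N.+1).+1)%N by lia.
have -> : altH (p.-1 - N.+1) = altH (p.-1 - N)
    - (- 1) ^+ (p.-1 - N.+1) * (p.-1 - N)%:R^-1 by rewrite e altHS; ring.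
have -> : (- 1) ^+ (p.-1 - N.+1) = - (- 1) ^+ N :> rat.
  rewrite -signr_odd -[in RHS]signr_odd.
  have -> : odd (p.-1 - N.+1) = ~~ odd N by lia.
  by case: (odd N); rewrite /= ?expr0 ?expr1 ?opprK.
rewrite altHS opprD addrA; apply: cgD; first by apply: IH; exact: ltnW.
rewrite mulNr opprK -mulrN; apply: cgMl; first by rewrite rpredX // rpredN rpred1.
by apply: cg_inv_opp => //; lia.
Qed.

(** The range u, ..., p - u is stable under i -> p - i, so the sum equals its opposite mod p, and 2
    is invertible. *)
Lemma sum_inv_symm p u v : prime p -> odd p -> (0 < u)%N -> (u + v = p.+1)%N ->
  cg p 1 (\sum_(u <= i < v) i%:R^-1) 0.
Proof.
move=> pp po u0 uv.
have h2 : 2^-1 \in zp p.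
  by apply: (zp_inv_lt p 2) => //; have := prime_gt1 pp; case: p po {pp uv} => [|[|[]]].
set s := \sum_(u <= i < v) _.
have -> : s = 2^-1 * (s + s) by field.
rewrite -[X in cg _ _ _ X](mulr0 2^-1); apply: cgMl => //.
rewrite {1}/s big_nat_rev /= -big_split /= big_nat.
suff h i : (u <= i < v)%N -> cg p 1 ((u + v - i.+1)%:R^-1 + i%:R^-1) 0.
  by have := cg_sum _ _ _ (index_iota u v) _ _ _ h; rewrite [X in cg _ _ _ X]big1.
move=> iuv; rewrite -[X in cg _ _ _ X](addNr i%:R^-1).
by apply: cgD; [apply: cg_inv_opp => //; lia|exact: cg_refl].
Qed.

(** Catalan's identity. It turns alternating sums into ranges to which [sum_inv_symm] can apply. *)
Lemma altH_even m : altH (2 * m) = \sum_(m.+1 <= i < (2 * m).+1) i%:R^-1.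
Proof.
elim: m => [|m IH]; first by rewrite /altH big_ord0 big_geq.
have e : m.+1%:R^-1 + \sum_(m.+2 <= i < (2 * m).+3) i%:R^-1
  = \sum_(m.+1 <= i < (2 * m).+1) i%:R^-1 + (2 * m).+1%:R^-1 + (2 * m).+2%:R^-1 :> rat.
  by rewrite -!big_nat_recr -?big_ltn //=; lia.
rewrite altH_evenS IH mulnS -[RHS](addKr m.+1%:R^-1) e.
have m0 : 0 <= m%:R :> rat by rewrite ler0n.
have e2 : (2 * m).+2%:R = 2 * m%:R + 2 :> rat by rewrite -natr1 natr_odd; ring.
by rewrite !addSn add0n e2 natr_odd; field; nz_tac.
Qed.

(** * Evaluation at -1/4, -1/3 and -1/6 *)

Lemma fact_natrS n : n.+1`!%:R = n.+1%:R * n`!%:R :> rat.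
Proof. by rewrite factS natrM. Qed.

Lemma fact_neq0 n : n`!%:R != 0 :> rat.
Proof. by rewrite pnatr_eq0 -lt0n fact_gt0. Qed.

Lemma bin_natr n m : (m <= n)%N ->
  'C(n, m)%:R = n`!%:R / (m`!%:R * (n - m)`!%:R) :> rat.
Proof.
by move=> mn; rewrite -(bin_fact mn) !natrM mulfK // mulf_neq0 ?fact_neq0.
Qed.

(** The factor (k - x)(k + 1 + x) becomes (k + 1/4)(k + 3/4), which matches the ratio of consecutive
    values of (4k)! / (k!^2 (2k)!). The values at -1/3 and -1/6 are treated alike. *)
Lemma lprod4 k : lprod (- (1 / 4)) k =
  'C(2 * k, k)%:R * 'C(4 * k, 2 * k)%:R / 64 ^+ k.
Proof.
have -> : 'C(2 * k, k)%:R * 'C(4 * k, 2 * k)%:R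
   = (4 * k)`!%:R / (k`!%:R ^+ 2 * (2 * k)`!%:R) :> rat.
  rewrite !bin_natr; try lia.
  have -> : (2 * k - k = k)%N by lia.
  have -> : (4 * k - 2 * k = 2 * k)%N by lia.
  by field; rewrite !fact_neq0.
elim: k => [|k IH]; first by rewrite lprod0 !muln0 fact0.
rewrite lprodS IH !mulnS !addSn !add0n !fact_natrS (exprS 64).
have k0 : 0 <= k%:R :> rat by rewrite ler0n.
field; rewrite expf_neq0 // !fact_neq0 /=; nz_tac.
Qed.

Lemma lprod3 k : lprod (- (1 / 3)) k =
  'C(2 * k, k)%:R * 'C(3 * k, k)%:R / 27 ^+ k.
Proof.
have -> : 'C(2 * k, k)%:R * 'C(3 * k, k)%:R
   = (3 * k)`!%:R / k`!%:R ^+ 3 :> rat.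
  rewrite !bin_natr; try lia.
  have -> : (2 * k - k = k)%N by lia.
  have -> : (3 * k - k = 2 * k)%N by lia.
  by field; rewrite !fact_neq0.
elim: k => [|k IH]; first by rewrite lprod0 !muln0 fact0.
rewrite lprodS IH !mulnS !addSn !add0n !fact_natrS (exprS 27).
have k0 : 0 <= k%:R :> rat by rewrite ler0n.
field; rewrite expf_neq0 // !fact_neq0 /=; nz_tac.
Qed.

Lemma lprod6 k : lprod (- (1 / 6)) k =
  'C(3 * k, k)%:R * 'C(6 * k, 3 * k)%:R / 432 ^+ k.
Proof.
have -> : 'C(3 * k, k)%:R * 'C(6 * k, 3 * k)%:R
   = (6 * k)`!%:R / (k`!%:R * (2 * k)`!%:R * (3 * k)`!%:R) :> rat.
  rewrite !bin_natr; try lia.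
  have -> : (3 * k - k = 2 * k)%N by lia.
  have -> : (6 * k - 3 * k = 3 * k)%N by lia.
  by field; rewrite !fact_neq0.
elim: k => [|k IH]; first by rewrite lprod0 !muln0 fact0.
rewrite lprodS IH !mulnS !addSn !add0n !fact_natrS (exprS 432).
have -> : k%:R * k.+1%:R - - (1 / 6) * (- (1 / 6) + 1)
  = (6 * k).+1%:R * (6 * k).+4.+1%:R / 36 :> rat by field.
have -> : (6 * k).+4.+2%:R = 6 * k.+1%:R :> rat by ring.
have -> : (6 * k).+4%:R = 2 * (3 * k).+2%:R :> rat by ring.
have -> : (6 * k).+3%:R = 3 * (2 * k).+1%:R :> rat by ring.
have -> : (6 * k).+2%:R = 2 * (3 * k).+1%:R :> rat by ring.
have -> : (3 * k).+3%:R = 3 * k.+1%:R :> rat by ring.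
have -> : (2 * k).+2%:R = 2 * k.+1%:R :> rat by ring.
have e0 : 432 ^+ k != 0 :> rat by rewrite expf_neq0.
have /= n0 (j : nat) : j.+1%:R != 0 :> rat by rewrite pnatr_eq0.
(* The factors are made opaque: normalising them as polynomials in k is slow. *)
move: (fact_neq0 k) (fact_neq0 (2 * k)) (fact_neq0 (3 * k)) (n0 k)
  (n0 (2 * k)) (n0 (3 * k)) (n0 (3 * k).+1) e0.
move: k`!%:R (2 * k)`!%:R (3 * k)`!%:R (6 * k)`!%:R k.+1%:R (2 * k).+1%:R
  (3 * k).+1%:R (3 * k).+2%:R (6 * k).+1%:R (6 * k).+4.+1%:R (432 ^+ k).
move=> f1 f2 f3 f6 x1 x2 x3 x4 x5 x6 x7 f10 f20 f30 x10 x20 x30 x40 x70.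
by field; rewrite f10 f20 f30 x10 x20 x30 x40 x70.
Qed.

(** Needed when p = -1 mod d: then -1 - x, not x, has the form m + pt. *)
Lemma lsum_reflect x n : lsum (- 1 - x) n = lsum x n.
Proof. by apply: eq_bigr => k _; rewrite lprod_reflect. Qed.

(** Here c is the weight of the Fermat quotient (2^p - 2) / p in [altH (2 * m)] mod p, e the
    constant correction, and f the inverse of 2m + 1. The three points have c = 1/2, 0 and 1. *)
Lemma lsum_eval (p n m : nat) (t c e f : rat) : prime p -> p = n.*2.+1 ->
  t \in zp p -> p%:R * t \isn't a Num.int -> (m < n)%N -> c \in zp p ->
  cg p 1 (altH (2 * m)) (c * altH p.-1 + e) ->
  cg p 1 (2 * m).+1%:R^-1 f ->
  forall a, a = m%:R + p%:R * t -> cg p 2 (lsum a n)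
    ((2 * a + 1) * (- 1 + 2 * t * (2 * c - 1) * (2 ^+ p - 2)
                    + p%:R * (2 * t * (2 * e + f)))).
Proof.
move=> pp pn tp tint mn cp h1 h2 a aE; have p0 := prime_gt0 pp.
apply: cg_trans (lsum_congr _ _ _ _ pp pn tp tint mn _ aE) _.
apply: cgMl; first by rewrite aE; zp_tac.
have -> : (2 * n = p.-1)%N by clear -pn; lia.
have [//|z1 zz1 e1] := cgP _ _ _ _ _ (altH_fermat p pp).
have [//|z2 zz2 e2] := cgP _ _ _ _ _ h1.
have [//|z3 zz3 e3] := cgP _ _ _ _ _ h2.
apply/cgP => //.
exists (2 * t * (2 * c - 1) * z1 + 4 * t * z2 + 2 * t * z3); first by zp_tac.
rewrite e2 e3.
transitivity (- 1 + 2 * t * (2 * c - 1) * (p%:R * altH p.-1)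
  + p%:R * (2 * t * (2 * e + f)) + p%:R ^+ 2 * (4 * t * z2 + 2 * t * z3)).
  by ring.
by rewrite e1; ring.
Qed.

Lemma cg_inv_eq (p k : nat) (x z : rat) : prime p -> (0 < k < p)%N -> z \in zp p ->
  k%:R * x = 1 + p%:R * z -> cg p 1 k%:R^-1 x.
Proof.
move=> pp kp zz e; have k0 : k%:R != 0 :> rat by rewrite pnatr_eq0; lia.
apply/cgP; first exact: prime_gt0.
exists (- (z * k%:R^-1)); first by zp_tac; exact: zp_inv_lt.
have -> : x = (1 + p%:R * z) / k%:R by rewrite -e mulrC mulKf.
by field.
Qed.

Lemma altH_third1 p m : prime p -> odd p -> p = (3 * m + 1)%N ->
  cg p 1 (altH (2 * m)) 0.
Proof. by move=> pp po pm; rewrite altH_even; apply: sum_inv_symm => //; lia. Qed.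

(** The extra term 1 / (2m+1) completes the range m+1, ..., 2m+1, whose ends add up to p. *)
Lemma altH_third2 p m : prime p -> odd p -> p = (3 * m + 2)%N ->
  cg p 1 (altH (2 * m) + (2 * m).+1%:R^-1) 0.
Proof.
move=> pp po pm; rewrite altH_even -big_nat_recr /=; last by lia.
by apply: sum_inv_symm => //; lia.
Qed.

Lemma nonint_frac (p d : nat) : (0 < d)%N -> ~~ (d %| p)%N ->
  (p%:R * - (1 / d%:R) : rat) \isn't a Num.int.
Proof.
move=> d0; apply: contra => /intrP[z e].
have {e} : p%:Z = - z * d%:Z.
  apply: (@intr_inj rat); rewrite rmorphM rmorphN /= -!pmulrn -e.
  by field; rewrite pnatr_eq0 -lt0n.
move=> e; suff: (d%:Z %| p%:Z)%Z by [].
by rewrite e dvdz_mull.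
Qed.

(** Integrality of the left-hand side is inherited from the right-hand side. *)
Lemma pcongr_cg p n x y : (0 < p)%N -> cg p n x y -> y \in zp p -> pcongr p n x y.
Proof.
move=> p0 /(cgP _ _ _ _ p0)[z zz ->] yz; split=> //.
  by apply: (_ : _ \in zp p); zp_tac.
by exists z => //; rewrite addrC addKr.
Qed.

Lemma prime_gt3_zp p : prime p -> (3 < p)%N ->
  [/\ 2^-1 \in zp p, 3^-1 \in zp p & odd p].
Proof.
move=> pp p3; split; try by apply: zp_inv_lt => //; lia.
by have [e|//] := even_prime pp; move: p3; rewrite e.
Qed.

(** Here c = 1/2, so 2c - 1 = 0 and no power of 2 survives. *)
Lemma lsum4_congr p : prime p -> (3 < p)%N ->
  cg p 2 (lsum (- (1 / 4)) p./2)
    ((- 1) ^+ ((p + 1) %/ 2) * ((p%:R + 1) / 2)).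
Proof.
move=> pp p3; have [h2 h3 po] := prime_gt3_zp p pp p3.
have pn : p = (p./2).*2.+1 by lia.
have tz : - (1 / 4%:R) \in zp p.
  have -> : - (1 / 4) = - (2^-1 * 2^-1) :> rat by field.
  by rewrite rpredN rpredM.
have tint : (p%:R * - (1 / 4%:R) : rat) \isn't a Num.int.
  by apply: nonint_frac => //; lia.
(* Reflection at the midpoint M = (p-1)/2 maps [altH M] to [altH p.-1 - altH M]. *)
have half M : p.-1 = (2 * M)%N -> cg p 1 (altH M) (2^-1 * altH p.-1).
  move=> pM; have -> : altH M = 2^-1 * (altH M + altH M) by field.
  have -> : 2^-1 * altH p.-1 = 2^-1 * (altH p.-1 - altH M + altH M) by field.
  apply: cgMl => //; apply: cgD; last exact: cg_refl.
  have {1}-> : M = (p.-1 - M)%N by clear -pM; lia.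
  by apply: altH_reflect => //; clear -pM p3; lia.
have [m [pm|pm]] : exists m, p = (4 * m + 1)%N \/ p = (4 * m + 3)%N.
  by exists (p %/ 4)%N; clear -po; lia.
- have pE : p%:R = 4 * m%:R + 1 :> rat by rewrite pm natrD natrM.
  have mn : (m < p./2)%N by clear -pm p3; lia.
  have mp : (0 < (2 * m).+1 < p)%N by clear -pm p3; lia.
  have hH : cg p 1 (altH (2 * m)) (2^-1 * altH p.-1 + 0).
    by rewrite addr0; apply: half; clear -pm; lia.
  (* 2 (2m+1) = 1 + p. *)
  have hI : cg p 1 (2 * m).+1%:R^-1 2.
    apply: (cg_inv_eq _ _ _ 1) => //; first exact: rpred1.
    by rewrite natr_odd pE; ring.
  have := lsum_eval _ _ _ _ _ _ _ pp pn tz tint mn h2 hH hI (- (1 / 4)).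
  have -> : ((p + 1) %/ 2 = (2 * m).+1)%N by clear -pm; lia.
  rewrite exprS exprM sqrrN !expr1n => h.
  apply: cg_trans (h _) _; first by rewrite pE; field.
  by rewrite [X in cg _ _ X](_ : _ = (-1 * 1 * ((p%:R + 1) / 2)));
    [exact: cg_refl|field].
- have pE : p%:R = 4 * m%:R + 3 :> rat by rewrite pm natrD natrM.
  have mn : (m < p./2)%N by clear -pm p3; lia.
  have mp : (0 < (2 * m).+1 < p)%N by clear -pm p3; lia.
  have hI : cg p 1 (2 * m).+1%:R^-1 (- 2).
    apply: (cg_inv_eq _ _ _ (- 1)) => //; first by rewrite rpredN rpred1.
    by rewrite natr_odd pE; ring.
  (* The midpoint is now 2m + 1, so one term is removed, with inverse -2. *)
  have hH : cg p 1 (altH (2 * m)) (2^-1 * altH p.-1 - - 2).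
    have -> : altH (2 * m) = altH (2 * m).+1 - (2 * m).+1%:R^-1.
      by rewrite altHS exprM sqrrN !expr1n; ring.
    by apply: cgD; [apply: half; clear -pm; lia|exact: cgN].
  have := lsum_eval _ _ _ _ _ _ _ pp pn tz tint mn h2 hH hI (- 1 - - (1 / 4)).
  rewrite lsum_reflect.
  have -> : ((p + 1) %/ 2 = 2 * (m + 1))%N by clear -pm; lia.
  rewrite exprM sqrrN !expr1n => h.
  apply: cg_trans (h _) _; first by rewrite pE; field.
  by rewrite [X in cg _ _ X](_ : _ = (1 * ((p%:R + 1) / 2)));
    [exact: cg_refl|field].
Qed.

(** Here c = 0 because the middle third of the harmonic sum vanishes mod p. The factor 2a + 1 is 1/3
    or -1/3 and supplies the Legendre symbol. *)
Lemma lsum3_congr p : prime p -> (3 < p)%N ->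
  cg p 2 (lsum (- (1 / 3)) p./2)
    (1 / 9 * legendre3 p * (2 ^+ (p + 1) - 7 - 6 * p%:R)).
Proof.
move=> pp p3; have [h2 h3 po] := prime_gt3_zp p pp p3.
have pn : p = (p./2).*2.+1 by lia.
have tz : - (1 / 3%:R) \in zp p by rewrite mul1r rpredN.
have nd : ~~ (3 %| p)%N by rewrite dvdn_prime2 //; lia.
have tint : (p%:R * - (1 / 3%:R) : rat) \isn't a Num.int.
  by apply: nonint_frac.
have z0 : 0 \in zp p by exact: rpred0.
rewrite exprD expr1.
have [m [pm|pm]] : exists m, p = (3 * m + 1)%N \/ p = (3 * m + 2)%N.
  by exists (p %/ 3)%N; clear -nd; lia.
- have pE : p%:R = 3 * m%:R + 1 :> rat by rewrite pm natrD natrM.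
  have l3 : (p %% 3 = 1)%N by clear -pm; lia.
  have mn : (m < p./2)%N by clear -pm p3; lia.
  have mp : (0 < (2 * m).+1 < p)%N by clear -pm p3; lia.
  have hH : cg p 1 (altH (2 * m)) (0 * altH p.-1 + 0).
    by rewrite mul0r addr0; apply: altH_third1.
  have hI : cg p 1 (2 * m).+1%:R^-1 3.
    apply: (cg_inv_eq _ _ _ 2) => //.
    by rewrite natr_odd pE; ring.
  have h := lsum_eval _ _ _ _ _ _ _ pp pn tz tint mn z0 hH hI (- (1 / 3)).
  apply: cg_trans (h _) _; first by rewrite pE; field.
  have -> : legendre3 p = 1 by rewrite /legendre3 l3.
  by rewrite [X in cg _ _ X](_ : _ = 1 / 9 * 1 * (2 ^+ p * 2 - 7 - 6 * p%:R));
    [exact: cg_refl|field].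
- have pE : p%:R = 3 * m%:R + 2 :> rat by rewrite pm natrD natrM.
  have l3 : (p %% 3 = 2)%N by clear -pm; lia.
  have mn : (m < p./2)%N by clear -pm p3; lia.
  have mp : (0 < (2 * m).+1 < p)%N by clear -pm p3; lia.
  have hI : cg p 1 (2 * m).+1%:R^-1 (- 3).
    apply: (cg_inv_eq _ _ _ (- 2)) => //.
    by rewrite natr_odd pE; ring.
  have hH : cg p 1 (altH (2 * m)) (0 * altH p.-1 - - 3).
    have -> : altH (2 * m) = altH (2 * m) + (2 * m).+1%:R^-1 - (2 * m).+1%:R^-1.
      by rewrite addrK.
    by rewrite mul0r; apply: cgD; [exact: altH_third2|exact: cgN].
  have h := lsum_eval _ _ _ _ _ _ _ pp pn tz tint mn z0 hH hI (- 1 - - (1 / 3)).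
  rewrite lsum_reflect in h.
  apply: cg_trans (h _) _; first by rewrite pE; field.
  have -> : legendre3 p = - 1 by rewrite /legendre3 l3.
  by rewrite [X in cg _ _ X](_ : _ = 1 / 9 * (- 1) * (2 ^+ p * 2 - 7 - 6 * p%:R));
    [exact: cg_refl|field].
Qed.

(** Here c = 1, and 2a + 1 is 2/3 or -2/3, with the sign of the Legendre symbol. *)
Lemma lsum6_congr p : prime p -> (3 < p)%N ->
  cg p 2 (lsum (- (1 / 6)) p./2)
    (- (1 / 9) * legendre3 p * (2 ^+ (p + 1) + 2 + 3 * p%:R)).
Proof.
move=> pp p3; have [h2 h3 po] := prime_gt3_zp p pp p3.
have p0 := prime_gt0 pp.
have pn : p = (p./2).*2.+1 by lia.
have tz : - (1 / 6%:R) \in zp p.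
  have -> : - (1 / 6) = - (2^-1 * 3^-1) :> rat by field.
  by rewrite rpredN rpredM.
have nd : ~~ (3 %| p)%N by rewrite dvdn_prime2 //; lia.
have tint : (p%:R * - (1 / 6%:R) : rat) \isn't a Num.int.
  by apply: nonint_frac => //; lia.
have z1 : 1 \in zp p by exact: rpred1.
rewrite exprD expr1.
have [m [pm|pm]] : exists m, p = (6 * m + 1)%N \/ p = (6 * m + 5)%N.
  by exists (p %/ 6)%N; clear -po nd; lia.
- have pE : p%:R = 6 * m%:R + 1 :> rat by rewrite pm natrD natrM.
  have l3 : (p %% 3 = 1)%N by clear -pm; lia.
  have mn : (m < p./2)%N by clear -pm p3; lia.
  have mp : (0 < (2 * m).+1 < p)%N by clear -pm p3; lia.
  (* Reflection sends 2m to 4m, and p = 3(2m) + 1 makes [altH] vanish there mod p. *)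
  have hH : cg p 1 (altH (2 * m)) (1 * altH p.-1 + 0).
    have := altH_reflect p (2 * m) pp po; have -> : (p.-1 - 2 * m = 2 * (2 * m))%N by clear -pm; lia.
    move=> h; have {h} h := cg_trans _ _ _ _ _ (cg_sym _ _ _ _ (h _)) (altH_third1 p (2 * m) pp po _).
    have -> : altH (2 * m) = altH p.-1 + - (altH p.-1 - altH (2 * m)) by ring.
    have -> : 1 * altH p.-1 + 0 = altH p.-1 + - 0 by ring.
    apply: cgD; first exact: cg_refl.
    by apply: cgN; apply: h; clear -pm; lia.
  have hI : cg p 1 (2 * m).+1%:R^-1 (3 / 2).
    apply: (cg_inv_eq _ _ _ 2^-1) => //.
    by rewrite natr_odd pE; field.
  have h := lsum_eval _ _ _ _ _ _ _ pp pn tz tint mn z1 hH hI (- (1 / 6)).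
  apply: cg_trans (h _) _; first by rewrite pE; field.
  have -> : legendre3 p = 1 by rewrite /legendre3 l3.
  by rewrite [X in cg _ _ X](_ : _ = - (1 / 9) * 1 * (2 ^+ p * 2 + 2 + 3 * p%:R));
    [exact: cg_refl|field].
- have pE : p%:R = 6 * m%:R + 5 :> rat by rewrite pm natrD natrM.
  have l3 : (p %% 3 = 2)%N by clear -pm; lia.
  have mn : (m < p./2)%N by clear -pm p3; lia.
  have mp : (0 < (2 * m).+1 < p)%N by clear -pm p3; lia.
  have hI : cg p 1 (2 * m).+1%:R^-1 (- (3 / 2)).
    apply: (cg_inv_eq _ _ _ (- 2^-1)) => //.
    by rewrite natr_odd pE; field.
  have hH : cg p 1 (altH (2 * m)) (1 * altH p.-1 - - (3 / 2)).
    have -> : altH (2 * m) = altH (2 * m).+1 - (2 * m).+1%:R^-1.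
      by rewrite altHS exprM sqrrN !expr1n; ring.
    rewrite mul1r; apply: cgD; last exact: cgN.
    (* Reflection sends M to 2M + 1, and p = 3M + 2 makes [altH] vanish there mod p. *)
    set M := (2 * m).+1.
    have pM : p = (3 * M + 2)%N by rewrite /M; clear -pm; lia.
    have h := altH_third2 p M pp po pM.
    have r := altH_reflect p M pp po.
    have eM : (p.-1 - M = (2 * M).+1)%N by clear -pM; lia.
    rewrite eM altHS exprM sqrrN !expr1n mul1r in r.
    have -> : altH M = altH p.-1 + - (altH p.-1 - altH M) by ring.
    have -> : cg p 1 (altH p.-1 + - (altH p.-1 - altH M)) (altH p.-1)
      = cg p 1 (altH p.-1 + - (altH p.-1 - altH M)) (altH p.-1 + - 0).
      by congr cg; ring.
    apply: cgD; first exact: cg_refl.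
    by apply: cgN; apply: cg_trans (cg_sym _ _ _ _ (r _)) h; clear -pM; lia.
  have h := lsum_eval _ _ _ _ _ _ _ pp pn tz tint mn z1 hH hI (- 1 - - (1 / 6)).
  rewrite lsum_reflect in h.
  apply: cg_trans (h _) _; first by rewrite pE; field.
  have -> : legendre3 p = - 1 by rewrite /legendre3 l3.
  by rewrite [X in cg _ _ X](_ : _ = - (1 / 9) * (- 1) * (2 ^+ p * 2 + 2 + 3 * p%:R));
    [exact: cg_refl|field].
Qed.

Theorem theorem4p3 (p : nat) (p_prime : prime p) (p_gt3 : (3 < p)%N) :
  [/\ pcongr p 2
        (\sum_(0 <= k < ((p - 1) %/ 2).+1)
           ('C(2 * k, k)%:R * 'C(4 * k, 2 * k)%:R)
             / ((2 * k%:R - 1) * 64 ^+ k))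
        ((- 1) ^+ ((p + 1) %/ 2) * ((p%:R + 1) / 2)),
      pcongr p 2
        (\sum_(0 <= k < ((p - 1) %/ 2).+1)
           ('C(2 * k, k)%:R * 'C(3 * k, k)%:R)
             / ((2 * k%:R - 1) * 27 ^+ k))
        (1 / 9 * legendre3 p * (2 ^+ (p + 1) - 7 - 6 * p%:R))
    & pcongr p 2
        (\sum_(0 <= k < ((p - 1) %/ 2).+1)
           ('C(3 * k, k)%:R * 'C(6 * k, 3 * k)%:R)
             / ((2 * k%:R - 1) * 432 ^+ k))
        (- (1 / 9) * legendre3 p * (2 ^+ (p + 1) + 2 + 3 * p%:R))].
Proof.
have [h2 h3 po] := prime_gt3_zp p p_prime p_gt3.
have p0 := prime_gt0 p_prime.
have h9 : 1 / 9%:R \in zp p.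
  by have -> : 1 / 9 = 3^-1 * 3^-1 :> rat; [field|apply: rpredM].
have hl : legendre3 p \in zp p.
  by rewrite /legendre3; do 2?case: ifP => _; rewrite ?rpredN ?rpred0 ?rpred1.
have -> : ((p - 1) %/ 2 = p./2)%N by lia.
split; apply: pcongr_cg => //; try by zp_tac.
- suff <- : lsum (- (1 / 4)) p./2 = \sum_(0 <= k < (p./2).+1)
      ('C(2 * k, k)%:R * 'C(4 * k, 2 * k)%:R) / ((2 * k%:R - 1) * 64 ^+ k).
    exact: lsum4_congr.
  by apply: eq_bigr => k _; rewrite lprod4 invfM [RHS]mulrA [LHS]mulrAC.
- suff <- : lsum (- (1 / 3)) p./2 = \sum_(0 <= k < (p./2).+1)
      ('C(2 * k, k)%:R * 'C(3 * k, k)%:R) / ((2 * k%:R - 1) * 27 ^+ k).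
    exact: lsum3_congr.
  by apply: eq_bigr => k _; rewrite lprod3 invfM [RHS]mulrA [LHS]mulrAC.
- suff <- : lsum (- (1 / 6)) p./2 = \sum_(0 <= k < (p./2).+1)
      ('C(3 * k, k)%:R * 'C(6 * k, 3 * k)%:R) / ((2 * k%:R - 1) * 432 ^+ k).
    exact: lsum6_congr.
  by apply: eq_bigr => k _; rewrite lprod6 invfM [RHS]mulrA [LHS]mulrAC.
Qed.
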